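(* There exists an absolute constant $C>0$ such that the following holds. For positive integers $n$ and $k$ with $k\mid n$, let $\mathrm{Comb}_{n,k}$ denote the $n$-vertex tree consisting of a path $P$ on $n/k$ vertices together with $n/k$ pairwise vertex-disjoint paths on $k$ vertices each, one beginning at each vertex of $P$ (each such $k$-vertex path has one endpoint equal to a vertex of $P$ and is otherwise disjoint from $P$). Then for every choice of $k=k(n)$ with $k\mid n$, the random graph $\mathcal{G}(n,C\frac{\log n}{n})$ contains a copy of $\mathrm{Comb}_{n,k}$ with probability tending to $1$ as $n\to\infty$.
   Context: $\mathcal{G}(n,p)$ denotes the binomial random graph on vertex set $[n]=\{1,\dots,n\}$ in which each of the $\binom n2$ possible edges is present independently with probability $p$. $\log$ denotes the natural logarithm. *)

(* Defs.v *)
From HB Require Import structures.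
From mathcomp Require Import all_boot all_order all_algebra.
From mathcomp Require Import all_classical all_reals.
From mathcomp Require Import topology normedtype sequences exp.
Set Implicit Arguments. Unset Strict Implicit. Unset Printing Implicit Defensive.
Import Order.TTheory GRing.Theory Num.Theory.

(* A graph on vertex set 'I_n is encoded by its edge set, a set of pairs
   (i, j) with i < j (each unordered edge {i,j} stored once). *)
Definition upper_pairs (n : nat) : {set 'I_n * 'I_n} :=
  [set e | (nat_of_ord e.1 < nat_of_ord e.2)%N].

Definition gadj (n : nat) (E : {set 'I_n * 'I_n}) (u v : 'I_n) : bool :=
  ((u, v) \in E) || ((v, u) \in E).

(* The comb Comb with spine length m and teeth of k vertices: vertex (i, j)
   is the j-th vertex of the tooth hanging at spine vertex i; the spine P is
   (0,0) - (1,0) - ... - (m-1,0); tooth i is (i,0) - (i,1) - ... - (i,k-1). *)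
Definition comb_adj (m k : nat) (x y : 'I_m * 'I_k) : bool :=
  [&& (nat_of_ord x.2 == 0)%N, (nat_of_ord y.2 == 0)%N &
      ((x.1.+1 == y.1 :> nat) || (y.1.+1 == x.1 :> nat))]
  || ((x.1 == y.1) && ((x.2.+1 == y.2 :> nat) || (y.2.+1 == x.2 :> nat))).

Definition contains_comb (n m k : nat) (E : {set 'I_n * 'I_n}) : bool :=
  [exists f : {ffun 'I_m * 'I_k -> 'I_n},
     injectiveb f &&
     [forall x, forall y, comb_adj x y ==> gadj E (f x) (f y)]].

Local Open Scope ring_scope.

Definition gnp_prob (R : realType) (n : nat) (p : R)
    (Q : pred {set 'I_n * 'I_n}) : R :=
  \sum_(E : {set 'I_n * 'I_n} | (E \subset upper_pairs n) && Q E)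
     p ^+ #|E| * (1 - p) ^+ (#|upper_pairs n| - #|E|)%N.

Definition prob_comb (R : realType) (n k : nat) (p : R) : R :=
  @gnp_prob R n p (@contains_comb n (n %/ k) k).

(* Main.v *)
(* The uniformly random copy of the comb in the complete graph is
   [O(1/n)]-spread: a forest with [s] edges lies in it with probability at most
   [(C/n)^s], because a tree of bounded degree leaves boundedly many choices for
   every vertex whose parent has been placed. A spread family of sets of size at
   most [n] is hit by a random set of density [O(log n / n)]: after revealing a
   random set [W], almost every member [S_i] can be replaced by a fragment
   [S_j \ W], with [S_j] contained in the union of [W] and [S_i], of at most half
   the size. The fragments form again a spread family, so that [O(log n)] rounds
   of density [O(1/n)] reach constant size, and one round of density
   [O(log n / n)] finishes. *)
Require Import Defs.
From HB Require Import structures.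
From mathcomp Require Import all_boot all_order all_algebra.
From mathcomp Require Import ring lra zify.
Set Implicit Arguments. Unset Strict Implicit. Unset Printing Implicit Defensive.
Import Order.TTheory GRing.Theory Num.Theory.

(** * Spread of forests of bounded degree *)

Section Extensions.
Variables (V U : finType) (F : {set {ffun V -> U}}).
Implicit Types (g : {ffun V -> U}) (s : seq V).

Definition agreeing g s := [set g' in F | all (fun u => g' u == g u) s].

(** Values along [s] are exposed one at a time: [b u] bounds the choices at [u] once [p] and the
    earlier entries are fixed, and [B] bounds the completions at the end. The prefix [p] collects
    what the induction has already exposed. *)
Lemma card_agreeing_cat (b : V -> nat) (B : nat) s g p :
  (forall s1 u s2 g', s = s1 ++ u :: s2 -> g' \in F ->
     #|[set g'' u | g'' : {ffun V -> U} in agreeing g' (p ++ s1)]| <= b u) ->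
  (forall g', g' \in F -> #|agreeing g' (p ++ s)| <= B) ->
  g \in F -> #|agreeing g p| <= (\prod_(u <- s) b u) * B.
Proof.
elim: s p g => [|u s IH] p g bP BP gF.
  by rewrite big_nil mul1n -[p]cats0 BP.
rewrite big_cons -mulnA.
set K := \prod_(_ <- s) _ * B in IH *.
rewrite -sum1_card.
rewrite (partition_big_imset (fun g' : {ffun V -> U} => g' u)) /=.
apply: leq_trans (_ : \sum_(y in [set g'' u | g'' : {ffun V -> U} in agreeing g p]) K <= _).
  apply: leq_sum => y /imsetP[g1 g1F ->]; rewrite sum1_card.
  have g1F' : g1 \in F by move: g1F; rewrite inE => /andP[].
  apply: leq_trans (subset_leq_card _) (IH (p ++ [:: u]) g1 _ _ g1F').
  - apply/subsetP => g2; rewrite !inE all_cat /= andbT.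
    rewrite unfold_in /= !inE -!andbA => /and3P[-> /allP g2p -> /=]; rewrite andbT; apply/allP => w wp.
    by move: g1F; rewrite inE => /andP[_ /allP/(_ _ wp)/eqP->]; apply: g2p.
  - by move=> s1 w s2 g' es g'F; rewrite -catA; apply: bP g'F; rewrite es.
  - by move=> g' g'F; rewrite -catA; apply: BP.
rewrite sum_nat_const leq_mul2r; apply/orP; right.
by have := bP [::] u s g erefl gF; rewrite cats0.
Qed.
End Extensions.

Section ForestSpread.
(* [depth] together with [parent_uniq] makes [adj] a rooted forest. *)
Variables (n d : nat) (U : finType) (adj : rel U) (depth : U -> nat).
Hypothesis cardU : #|U| = n.
Hypothesis adj_sym : symmetric adj.
Hypothesis depth_adj : forall x y, adj x y -> depth x != depth y.
Hypothesis parent_uniq : forall x y z, adj x y -> adj x z ->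
  depth y < depth x -> depth z < depth x -> y = z.
Hypothesis deg_le : forall x, #|[set y | adj x y]| <= d.

Implicit Types (g : {ffun 'I_n -> U}) (T : {set 'I_n * 'I_n}).

(** The map [g] labels graph vertices by forest vertices; for injective [g] the embedding of the
    forest is its inverse, and this set is the embedded copy. *)
Definition edges g : {set 'I_n * 'I_n} :=
  [set e : 'I_n * 'I_n | (e.1 < e.2)%N && adj (g e.1) (g e.2)].

Definition injections : {set {ffun 'I_n -> U}} := [set g : {ffun 'I_n -> U} | injectiveb g].

(** On an edge of the copy, [lower] is the parent end and [upper] the child end. *)
Definition lower g (e : 'I_n * 'I_n) := if depth (g e.1) < depth (g e.2) then e.1 else e.2.
Definition upper g (e : 'I_n * 'I_n) := if depth (g e.1) < depth (g e.2) then e.2 else e.1.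

Lemma card_injections : #|injections| = n`!.
Proof.
rewrite card_inj_ffuns cardU card_ord; exact: ffactnn.
Qed.

Lemma lower_upper g e : e \in edges g ->
  adj (g (upper g e)) (g (lower g e)) /\ depth (g (lower g e)) < depth (g (upper g e)).
Proof.
rewrite inE /lower /upper => /andP[_ ad].
case: ltnP => [lt|ge]; first by rewrite adj_sym.
by split=> //; rewrite ltn_neqAle ge eq_sym depth_adj.
Qed.

(** A child determines its parent, hence the edge; storing pairs in increasing order excludes the
    reversed pair. *)
Lemma upper_inj g : g \in injections -> {in edges g &, injective (upper g)}.
Proof.
rewrite inE => /injectiveP gI e e' eg e'g eU.
have [ad lt] := lower_upper eg; have [ad' lt'] := lower_upper e'g.
have eL : lower g e = lower g e'.
  by apply: gI; apply: (parent_uniq ad); rewrite // eU.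
move: eg e'g eU eL; rewrite !inE /lower /upper; case: e {ad lt} => a b; case: e' {ad' lt'} => a' b' /=.
move=> /andP[ab _] /andP[ab' _].
case: ifP => _; case: ifP => _ e1 e2; subst=> //.
  by move: (ltn_trans ab ab'); rewrite ltnn.
by move: (ltn_trans ab ab'); rewrite ltnn.
Qed.

Lemma card_edges_le g : g \in injections -> #|edges g| <= n.
Proof.
move=> gI; rewrite -(card_in_imset (upper_inj gI)).
by rewrite -[leqRHS](card_ord n) max_card.
Qed.

Lemma card_agreeing_injections g (B : {set 'I_n}) : g \in injections ->
  #|agreeing injections g (enum B)| <= (n - #|B|)`!.
Proof.
move=> gI; set s := enum (~: B).
have sz : size s = n - #|B| by rewrite -cardE cardsCs setCK card_ord.
have us : uniq s by rewrite enum_uniq.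
(* The vertices outside [B] are exposed in the order of [s]; injectivity forbids the values taken on
   [B] and on the earlier entries. *)
apply: leq_trans (card_agreeing_cat (s := s) (B := 1)
  (b := fun u => n - #|B| - index u s) _ _ gI) _.
- move=> s1 u s2 g' es g'I.
  have gu : index u s = size s1.
    rewrite es index_cat /= eqxx addn0; move: us; rewrite es cat_uniq => /and3P[_].
    by rewrite /= negb_or => /andP[/negbTE ->].
  rewrite gu.
  have up : uniq (enum B ++ s1).
    rewrite cat_uniq enum_uniq /=; move: us; rewrite es cat_uniq => /andP[-> _].
    rewrite andbT; apply/hasPn => w ws1; rewrite /= mem_enum.
    have : w \in s by rewrite es mem_cat ws1.
    by rewrite mem_enum inE.
  have -> : n - #|B| - size s1 = #|~: (g' @: [set w in enum B ++ s1])|.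
    rewrite [RHS]cardsCs setCK cardU card_imset; last by move: g'I; rewrite inE => /injectiveP.
    by rewrite cardsE (card_uniqP up) size_cat -cardE subnDA.
  apply: subset_leq_card; apply/subsetP => _ /imsetP[g2 g2I ->].
  move: g2I; rewrite !inE => /andP[/injectiveP g2I /allP g2E].
  apply/negP => /imsetP[w]; rewrite inE => wB gE.
  have := g2E w wB; rewrite -gE => /eqP/g2I uw.
  have : uniq (enum B ++ s).
    rewrite cat_uniq !enum_uniq andbT /=; apply/hasPn => w'.
    by rewrite /= !mem_enum inE.
  rewrite es catA cat_uniq => /and3P[_ /hasPn /(_ u)].
  by rewrite mem_head -uw wB => /(_ isT).
- move=> g' g'I; apply: leq_trans (_ : #|[set g']| <= _); last by rewrite cards1.
  apply: subset_leq_card; apply/subsetP => g2; rewrite !inE => /andP[_ /allP g2E].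
  apply/eqP/ffunP => u; apply/eqP/g2E; rewrite mem_cat !mem_enum inE; exact: orbN.
rewrite muln1 -sz -ffactnn ffact_prod.
case: (posnP (size s)) => [s0|s0].
  by rewrite (size0nil s0) big_nil big_ord0.
have x0 : 'I_n by case: (s) s0.
rewrite (big_nth x0) big_mkord leq_eqVlt; apply/orP; left; apply/eqP.
by apply: eq_bigr => i _; rewrite index_uniq.
Qed.

(* A fixed [g0] with [T \subset edges g0] orients [T] into a forest of rooted
   trees. Exposing the vertices of [T] by increasing depth under [g0], each of
   the [#|T|] non-roots has at most [d] possible images. *)
Lemma card_edges_sup T : exists v,
  [/\ v <= n, v <= #|T|.*2 &
   #|[set g in injections | T \subset edges g]| * n ^ #|T| <= d ^ #|T| * (n ^ v * (n - v)`!)].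
Proof.
set F := [set g in _ | _].
have [->|[g0 g0F]] := set_0Vmem F; first by exists 0; rewrite cards0.
have [g0I Tg0] : g0 \in injections /\ T \subset edges g0.
  by move: g0F; rewrite inE => /andP[].
have Te e : e \in T -> e \in edges g0 by apply: (subsetP Tg0).
(* [tails] are the non-roots of the forest [T], and [B] is the set of all its vertices. *)
pose tails := upper g0 @: T; pose B := tails :|: lower g0 @: T.
have ctails : #|tails| = #|T|.
  by apply: card_in_imset => e e' eT e'T; apply: (upper_inj g0I); apply: Te.
have cB : #|B| <= #|T|.*2.
  by rewrite -addnn (leq_trans (leq_card_setU _ _)) // ctails leq_add2l leq_imset_card.
have cBn : #|B| <= n by rewrite -[leqRHS](card_ord n) max_card.
exists #|B|; split=> //.
pose dle := relpre (fun u => depth (g0 u)) leq.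
have ltot : total dle by move=> u w; apply: leq_total.
have ltr : transitive dle by move=> u w z; apply: leq_trans.
pose s := sort dle (enum B).
have sE : perm_eq s (enum B) by rewrite perm_sort.
have s_sorted : sorted dle s by apply: sort_sorted.
(* Sorting by depth exposes the parent of a non-root before it, which leaves [d] choices; a root is
   left free. *)
pose b u := if u \in tails then d else n.
have -> : F = agreeing F g0 [::] by apply/setP => g; rewrite !inE andbT.
have prodb : \prod_(u <- s) b u = d ^ #|T| * n ^ (#|B| - #|T|).
  rewrite (perm_big _ sE) /= big_enum /= (bigID (mem tails)) /=; congr (_ * _).
    rewrite (eq_bigr (fun=> d)) => [|u /andP[_ ut]]; last by rewrite /b ut.
    rewrite prod_nat_const -ctails; congr (_ ^ _); apply: eq_card => u.
    by rewrite unfold_in /= !inE; case: (u \in tails); rewrite ?orbT ?andbF.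
  rewrite (eq_bigr (fun=> n)) => [|u /andP[_ ut]]; last by rewrite /b (negbTE ut).
  rewrite prod_nat_const -ctails; congr (_ ^ _).
  rewrite -[in RHS](cardsID tails B) setUK addKn; apply: eq_card => u.
  by rewrite unfold_in /= !inE andbC.
have -> : n ^ #|T| = n ^ #|tails| by rewrite ctails.
apply: leq_trans (leq_mul (card_agreeing_cat (s := s) (b := b) (B := (n - #|B|)`!) _ _ g0F)
  (leqnn _)) _.
- move=> s1 u s2 g es gF; rewrite /b.
  case: ifP => [/imsetP[e eT uE]|_]; last first.
    by apply: leq_trans (max_card _) _; rewrite cardU.
  have [ad lt] := lower_upper (Te e eT).
  have ws1 : lower g0 e \in s1.
    have : lower g0 e \in s.
      by rewrite (perm_mem sE) mem_enum inE orbC imset_f.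
    rewrite es mem_cat in_cons => /orP[//|/orP[/eqP wu|ws2]].
      by move: lt; rewrite wu -uE ltnn.
    move: s_sorted; rewrite es sorted_cat_cons // => /andP[_].
    rewrite (path_sortedE ltr) => /andP[/allP/(_ _ ws2) /=].
    by rewrite leqNgt uE lt.
  apply: leq_trans (deg_le (g (lower g0 e))).
  apply: subset_leq_card; apply/subsetP => _ /imsetP[g2 g2F ->].
  move: g2F; rewrite !inE => /andP[/andP[_ /subsetP/(_ e eT)]].
  rewrite inE => /andP[_ ad2] /allP/(_ _ ws1)/eqP <-.
  rewrite uE /upper /lower; case: ifP => _ //.
  by rewrite adj_sym.
- move=> g gF; have gI : g \in injections by move: gF; rewrite inE => /andP[].
  apply: leq_trans (card_agreeing_injections B gI).
  apply: subset_leq_card; apply/subsetP => g2; rewrite !inE /= (perm_all _ sE).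
  by case/andP=> /andP[-> _] ->.
rewrite prodb ctails -!mulnA leq_mul2l; apply/orP; right.
rewrite [_`! * _]mulnC mulnA -expnD subnK // -ctails.
by apply: subset_leq_card; apply: subsetUl.
Qed.

End ForestSpread.

(** * The comb as a rooted tree of bounded degree *)

Section Comb.
Variables (m k : nat).
Implicit Types x y z : 'I_m * 'I_k.

(** The distance to the spine end [(0, 0)], taken as the root. *)
Definition comb_depth x : nat := x.1 + x.2.

Lemma comb_adj_sym : symmetric (@comb_adj m k).
Proof. by move=> [i j] [i' j']; rewrite /comb_adj /= -!val_eqE /=; lia. Qed.

Lemma comb_depth_adj x y : comb_adj x y -> comb_depth x != comb_depth y.
Proof.
by case: x y => [i j] [i' j']; rewrite /comb_adj /comb_depth /= -!val_eqE /=; lia.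
Qed.

Lemma comb_parent_uniq x y z : comb_adj x y -> comb_adj x z ->
  comb_depth y < comb_depth x -> comb_depth z < comb_depth x -> y = z.
Proof.
case: x y z => [i j] [i1 j1] [i2 j2]; rewrite /comb_adj /comb_depth /= -!val_eqE /=.
by move=> *; congr (_, _); apply: val_inj => /=; lia.
Qed.

(** Two bits identify a neighbour: whether it lies in the same tooth, and whether it is farther from
    the root. *)
Lemma comb_deg_le x : #|[set y | comb_adj x y]| <= 4.
Proof.
pose code y := (y.1 == x.1, comb_depth x < comb_depth y).
rewrite -(@card_in_imset _ _ code) => [|y z].
  by apply: leq_trans (max_card _) _; rewrite card_prod card_bool.
rewrite !inE /code; case: x y z {code} => [i j] [i1 j1] [i2 j2].
rewrite /comb_adj /comb_depth /= -!val_eqE /= => ad1 ad2 [e1 e2].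
by congr (_, _); apply: val_inj => /=; lia.
Qed.

(** Since [m * k = n], an injective labelling is bijective, and its inverse embeds the comb. *)
Lemma contains_comb_edges n (g : {ffun 'I_n -> 'I_m * 'I_k}) (E : {set 'I_n * 'I_n}) :
  (m * k)%N = n -> injective g -> edges (@comb_adj m k) g \subset E -> contains_comb m k E.
Proof.
move=> mk gI /subsetP sE.
have [f fK gK] : bijective g.
  by apply: inj_card_bij => //; rewrite card_prod !card_ord mk.
apply/existsP; exists (finfun f); apply/andP; split.
  by apply/injectiveP => x y; rewrite !ffunE; apply: (can_inj gK).
apply/'forall_'forall_implyP => x y; rewrite !ffunE => ad.
rewrite -(gK x) -(gK y) in ad.
case: (ltngtP (f x) (f y)) => [lt|lt|/val_inj fxy]; rewrite /gadj.
- by rewrite sE // inE lt.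
- by apply/orP; right; rewrite sE // inE /= lt comb_adj_sym.
- by have := comb_depth_adj ad; rewrite fxy eqxx.
Qed.

End Comb.

(** * Random sets and spread families *)

Local Open Scope ring_scope.

Section RandomSubset.
Variables (R : realFieldType) (X : finType).
Implicit Types (D W Z : {set X}) (p q : R) (f g : {set X} -> R).

(** The probability that [W] is the random subset of [D] keeping each element independently with
    probability [p]. *)
Definition weight D p W : R := p ^+ #|W| * (1 - p) ^+ (#|D| - #|W|).

Definition expect D p f : R := \sum_(W : {set X} | W \subset D) weight D p W * f W.

Lemma weight_ge0 D p W : 0 <= p <= 1 -> 0 <= weight D p W.
Proof. by case/andP=> p0 p1; rewrite mulr_ge0 ?exprn_ge0 ?subr_ge0. Qed.

Lemma eq_expect D p f g : f =1 g -> expect D p f = expect D p g.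
Proof. by move=> fg; apply: eq_bigr => W _; rewrite fg. Qed.

Lemma ler_expect D p f g : 0 <= p <= 1 ->
  (forall W, W \subset D -> f W <= g W) -> expect D p f <= expect D p g.
Proof.
by move=> p01 fg; apply: ler_sum => W WD; rewrite ler_wpM2l ?weight_ge0 ?fg.
Qed.

Lemma expect_lin D p a b f g :
  expect D p (fun W => a * f W + b * g W) = a * expect D p f + b * expect D p g.
Proof.
rewrite /expect !big_distrr -big_split /=; apply: eq_bigr => W _.
by ring.
Qed.

Lemma expect_set0 p f : expect set0 p f = f set0.
Proof.
rewrite /expect (big_pred1 set0) => [|W]; last by rewrite subset0.
by rewrite /weight cards0 subnn !expr0 !mul1r.
Qed.

(** Conditioning on whether [x] is kept; this recursion drives the inductions on [D]. *)
Lemma expect_setU1 x D p f : x \notin D ->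
  expect (x |: D) p f
  = p * expect D p (fun W => f (x |: W)) + (1 - p) * expect D p f.
Proof.
move=> xD; rewrite /expect (bigID (fun W : {set X} => x \in W)) /=.
congr (_ + _); rewrite big_distrr /=.
- rewrite (reindex_onto (fun W => x |: W) (fun W => W :\ x)) /=; last first.
    by move=> W /andP[_ xW]; rewrite setD1K.
  apply: eq_big => [W|W /andP[_ /eqP eW]].
    rewrite setU11 andbT; apply/andP/idP => [[/subsetP sW /eqP eW]|sW].
      apply/subsetP => y yW; have := sW y; rewrite !inE yW orbT => /(_ isT).
      by case/orP=> // /eqP yx; move: yW; rewrite yx -eW !inE eqxx.
    split; first by rewrite setUS.
    by rewrite setU1K //; apply: contra xD; apply: (subsetP sW).
  have xW : x \notin W by rewrite -eW !inE eqxx.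
  by rewrite /weight !cardsU1 xW xD add1n subSS exprS !mulrA.
- have sWD W : (W \subset x |: D) && (x \notin W) = (W \subset D).
    apply/andP/idP => [[/subsetP sW xW]|sW].
      apply/subsetP => y yW; have := sW y yW; rewrite !inE => /orP[/eqP yx|//].
      by move: xW; rewrite -yx yW.
    split; first exact: subset_trans sW (subsetUr _ _).
    by apply: contra xD; apply: (subsetP sW).
  apply: eq_big => // W; rewrite sWD => WD.
  by rewrite /weight cardsU1 xD add1n subSn ?subset_leq_card // exprS; ring.
Qed.

Lemma set_ind (P : {set X} -> Prop) :
  P set0 -> (forall x D, x \notin D -> P D -> P (x |: D)) -> forall D, P D.
Proof.
move=> P0 PU D; elim: {D}#|D| {-2}D (erefl #|D|) => [|n IH] D cD.
  by rewrite (cards0_eq cD).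
have /card_gt0P[x xD] : (0 < #|D|)%N by rewrite cD.
rewrite -(setD1K xD); apply: PU; first by rewrite !inE eqxx.
by apply: IH; move: cD; rewrite (cardsD1 x) xD => -[].
Qed.

Lemma expect_cst D p a : expect D p (fun=> a) = a.
Proof.
elim/set_ind: D => [|x D xD IH]; first exact: expect_set0.
by rewrite expect_setU1 // IH; ring.
Qed.

(** Two independent rounds merge into one: an element is missed by both with probability
    [(1 - p) * (1 - q)]. *)
Lemma expect_union D p q f :
  expect D p (fun W => expect D q (fun Z => f (W :|: Z)))
  = expect D (p + q - p * q) f.
Proof.
elim/set_ind: D f => [|x D xD IH] f; first by rewrite !expect_set0 setU0.
rewrite !expect_setU1 // -!IH.
have E W : expect (x |: D) q (fun Z => f (W :|: Z)) =
    q * expect D q (fun Z => f (x |: (W :|: Z)))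
    + (1 - q) * expect D q (fun Z => f (W :|: Z)).
  by rewrite expect_setU1 //; congr (_ * _ + _); apply: eq_expect => Z; rewrite setUCA.
rewrite (eq_expect _ _ E) expect_lin.
have E' W : expect (x |: D) q (fun Z => f ((x |: W) :|: Z)) =
    expect D q (fun Z => f (x |: (W :|: Z))).
  rewrite expect_setU1 // (@eq_expect _ _ _ (fun Z => f (x |: (W :|: Z)))) => [|Z].
    rewrite (@eq_expect _ _ (fun Z => f (x |: W :|: Z)) (fun Z => f (x |: (W :|: Z)))) => [|Z].
      by ring.
    by rewrite setUA.
  by rewrite -!setUA [W :|: _]setUCA !setUA setUid.
rewrite (eq_expect _ _ E'); ring.
Qed.

(** Coupling: the denser set is the sparser one with an independent round added, of density [s]
    solving [(1 - p) * (1 - s) = 1 - q]. *)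
Lemma ler_expect_prob D p q f : 0 <= p -> p <= q -> q <= 1 ->
  (forall W Z, W \subset Z -> f Z <= f W) -> expect D q f <= expect D p f.
Proof.
move=> p0; rewrite le_eqVlt => /predU1P[->//|pq] q1 mf.
pose s := (q - p) / (1 - p).
have p1 : 0 < 1 - p by rewrite subr_gt0 (lt_le_trans pq).
have -> : q = p + s - p * s.
  by rewrite /s; field; rewrite lt0r_neq0.
rewrite -expect_union; apply: ler_expect => [|W _].
  by rewrite p0 (le_trans (ltW pq)).
rewrite -[leRHS](expect_cst D s); apply: ler_expect => [|Z _].
  apply/andP; split; first by rewrite divr_ge0 ?(ltW p1) // subr_ge0 ltW.
  by rewrite ler_pdivrMr // mul1r lerD2r.
by apply: mf; apply: subsetUl.
Qed.

End RandomSubset.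

(** * Minimum fragments and rounds of exposure *)

Section Fragments.
Variables (R : realFieldType) (X I : finType) (D : {set X}) (kappa M : R).
Implicit Types (A : {set I}) (S : I -> {set X}) (W Z T : {set X}).

(** Spread in counting form, with [M] in the role of the size of the original family. Indices are
    counted rather than sets, since different indices may have equal fragments. *)
Definition spread A S :=
  forall T, #|[set i in A | T \subset S i]|%:R * kappa ^+ #|T| <= M.

Definition frag A S W i : {set X} :=
  S [arg min_(j < i | (j \in A) && (S j \subset W :|: S i)) #|S j :\: W|] :\: W.

(** The choice depends on [Z] alone, so a fragment can be encoded as a subset of it without knowing
    [W] or the index. *)
Definition anchor A S Z : {set X} :=
  if [pick j | (j \in A) && (S j \subset Z)] is Some j then S j else set0.

Lemma fragP A S W i : i \in A -> exists2 j, j \in A &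
  [/\ S j \subset W :|: S i, frag A S W i = S j :\: W &
   forall j', j' \in A -> S j' \subset W :|: S i -> #|frag A S W i| <= #|S j' :\: W|]%N.
Proof.
move=> iA; rewrite /frag.
case: arg_minnP => [|j /andP[jA sj] minj]; first by rewrite iA subsetUr.
by exists j => //; split=> // j' j'A sj'; apply: minj; rewrite j'A.
Qed.

Lemma frag_sub A S W i : i \in A -> frag A S W i \subset S i.
Proof.
by move=> iA; have [j _ [sj -> _]] := fragP S W iA; rewrite subDset.
Qed.

(* Any member of the family contained in [W :|: frag A S W i] competes with the
   minimiser, and its part outside [W] lies inside the fragment. *)
Lemma frag_sub_anchor A S W i : i \in A ->
  frag A S W i \subset anchor A S (W :|: frag A S W i).
Proof.
move=> iA; have [j jA [sj fE minf]] := fragP S W iA.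
rewrite /anchor; case: pickP => [j' /andP[j'A sj']|/(_ j)]; last first.
  by rewrite jA fE -subDset subxx.
have sj'W : S j' :\: W \subset frag A S W i by rewrite subDset.
have sj'i : S j' \subset W :|: S i.
  by apply: subset_trans sj' _; rewrite setUS ?frag_sub.
have /eqP <- : S j' :\: W == frag A S W i by rewrite eqEcard sj'W minf.
exact: subsetDl.
Qed.

(** Covering a fragment in a later round [Z] completes a member of the original family. *)
Lemma sub_setU_frag A S W Z i : i \in A -> frag A S W i \subset Z ->
  exists2 j, j \in A & S j \subset W :|: Z.
Proof.
move=> iA; have [j jA [_ -> _]] := fragP S W iA.
by rewrite subDset => sj; exists j.
Qed.

Lemma ler_sum_inj (J K : finType) (P : {set J}) (Q : {set K}) (h : J -> K)
    (F : J -> R) (G : K -> R) :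
  {in P &, injective h} -> {in P, forall j, h j \in Q} ->
  {in P, forall j, F j <= G (h j)} -> {in Q, forall k, 0 <= G k} ->
  \sum_(j in P) F j <= \sum_(k in Q) G k.
Proof.
move=> hI hQ FG G0; apply: le_trans (ler_sum _ FG) _.
rewrite -(big_imset _ hI) /= [leRHS](bigID (mem (h @: P))) /=.
rewrite [X in _ <= X + _](eq_bigl (mem (h @: P))) => [|k]; last first.
  rewrite andb_idl // => /imsetP[j jP ->]; exact: hQ.
by rewrite lerDl sumr_ge0 // => k /andP[/G0].
Qed.

(* The pair [(W, i)] is recovered from [Z = W :|: T], the fragment [T] and [i];
   given [Z] there are at most [2 ^ r] choices for [T], a subset of the anchor,
   and moving from [W] to [Z] costs a factor [p ^- #|T|]. *)
Lemma frag_large A S (r t : nat) (p : R) : 0 < p <= 1 -> 1 <= p * kappa ->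
  (forall i, i \in A -> S i \subset D) -> (forall i, i \in A -> #|S i| <= r)%N ->
  spread A S ->
  expect D p (fun W => #|[set i in A | (t < #|frag A S W i|)%N]|%:R)
    <= M * (2 ^+ r / (p * kappa) ^+ t.+1).
Proof.
move=> /andP[p0 p1] pk SD Sr spr.
have p01 : 0 <= p <= 1 by rewrite ltW.
have k0 : 0 < kappa by rewrite -(pmulr_rgt0 _ p0) (lt_le_trans ltr01).
have M0 : 0 <= M.
  by have := spr set0; rewrite cards0 expr0 mulr1; apply: le_trans.
have anchor_card Z : (#|anchor A S Z| <= r)%N.
  by rewrite /anchor; case: pickP => [j /andP[/Sr]|_] //; rewrite cards0.
pose P := [set a : {set X} * I |
  [&& a.1 \subset D, a.2 \in A & (t < #|frag A S a.1 a.2|)%N]].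
pose Q := [set b : {set X} * {set X} * I | [&& b.1.1 \subset D,
  b.1.2 \subset anchor A S b.1.1, (t < #|b.1.2|)%N, b.2 \in A & b.1.2 \subset S b.2]].
pose h (a : {set X} * I) := (a.1 :|: frag A S a.1 a.2, frag A S a.1 a.2, a.2).
pose G (b : {set X} * {set X} * I) := weight D p b.1.1 * p ^- #|b.1.2|.
have -> : expect D p (fun W => #|[set i in A | (t < #|frag A S W i|)%N]|%:R)
    = \sum_(a in P) weight D p a.1.
  rewrite (eq_bigl (fun a : {set X} * I =>
      (a.1 \subset D) && ((a.2 \in A) && (t < #|frag A S a.1 a.2|)%N))); last first.
    by move=> a; rewrite inE.
  rewrite -(pair_big_dep (fun W => W \subset D)
    (fun W i => (i \in A) && (t < #|frag A S W i|)%N) (fun W _ => weight D p W)) /=.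
  apply: eq_bigr => W _; rewrite sumr_const -[RHS]mulr_natr; congr (_ * _%:R).
  by apply: eq_card => i; rewrite !inE.
have fragW W i : i \in A -> W = (W :|: frag A S W i) :\: frag A S W i.
  move=> iA; have [j _ [_ -> _]] := fragP S W iA.
  by apply/setP => x; rewrite !inE; case: (x \in W); case: (x \in S j).
apply: (le_trans (ler_sum_inj (Q := Q) (h := h) (G := G) _ _ _ _)).
- move=> [W i] [W' i']; rewrite !inE /= => /and3P[_ iA _] /and3P[_ i'A _].
  rewrite /h /= => -[eZ eT eI]; congr (_, _) => //.
  by rewrite (fragW W i iA) (fragW W' i' i'A) eZ eT.
- move=> [W i]; rewrite !inE /= => /and3P[WD iA ->].
  rewrite iA frag_sub // frag_sub_anchor // subUset WD !andbT /=.
  exact: subset_trans (frag_sub S W iA) (SD i iA).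
- move=> [W i]; rewrite !inE /h /G /weight /= => /and3P[WD iA _].
  have TD : frag A S W i \subset D := subset_trans (frag_sub S W iA) (SD i iA).
  have cU : #|W :|: frag A S W i| = (#|W| + #|frag A S W i|)%N.
    have [j _ [_ -> _]] := fragP S W iA.
    rewrite cardsU [_ :&: _](_ : _ = set0) ?cards0 ?subn0 //.
    by apply/setP => x; rewrite !inE; case: (x \in W).
  have cD : (#|W :|: frag A S W i| <= #|D|)%N by rewrite subset_leq_card // subUset WD.
  (* The powers of [p] cancel; what remains holds because [Z] leaves fewer factors [1 - p]. *)
  rewrite cU exprD -!mulrA ler_pM2l ?exprn_gt0 // mulrCA.
  rewrite mulfV ?mulr1 ?expf_neq0 ?lt0r_neq0 //.
  rewrite ler_wiXn2l ?subr_ge0 // ?gerBl ?ltW //.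
  by rewrite leq_sub2l ?leq_addr.
- by move=> b _; rewrite mulr_ge0 ?weight_ge0 // invr_ge0 exprn_ge0 // ltW.
rewrite (eq_bigl (fun b : {set X} * {set X} * I => ((b.1.1 \subset D) &&
   ((b.1.2 \subset anchor A S b.1.1) && (t < #|b.1.2|)%N)) &&
    ((b.2 \in A) && (b.1.2 \subset S b.2)))); last first.
  by move=> b; rewrite inE -!andbA.
rewrite -(pair_big_dep (fun ZT : {set X} * {set X} => (ZT.1 \subset D) &&
   ((ZT.2 \subset anchor A S ZT.1) && (t < #|ZT.2|)%N))
   (fun ZT i => (i \in A) && (ZT.2 \subset S i))
   (fun ZT _ => weight D p ZT.1 * p ^- #|ZT.2|)) /=.
rewrite -(pair_big_dep (fun Z => Z \subset D)
  (fun Z T => (T \subset anchor A S Z) && (t < #|T|)%N)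
  (fun Z T => \sum_(i in A | T \subset S i) weight D p Z * p ^- #|T|)) /=.
rewrite -[leRHS](expect_cst D p); apply: ler_sum => Z ZD.
(* Spread leaves at most [M / kappa ^+ #|T|] indices for [T]; with the factor [p ^- #|T|],
   [1 <= p * kappa] and [t < #|T|], they contribute at most [b]. *)
pose b := M / (p * kappa) ^+ t.+1.
have b0 : 0 <= b by rewrite divr_ge0 // exprn_ge0 // (le_trans ler01).
apply: (@le_trans _ _ (\sum_(T in powerset (anchor A S Z)) weight D p Z * b)).
  rewrite [leRHS](bigID (fun T : {set X} => (t < #|T|)%N)) /=.
  rewrite [X in _ <= X + _](eq_bigl (fun T : {set X} =>
    (T \subset anchor A S Z) && (t < #|T|)%N)) => [|T]; last by rewrite inE.
  rewrite -[leLHS]addr0 lerD ?sumr_ge0 // => [|T _]; last by rewrite mulr_ge0 ?weight_ge0.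
  apply: ler_sum => T /andP[_ tT].
  rewrite sumr_const -mulr_natr -mulrA ler_wpM2l ?weight_ge0 //.
  have := spr T; rewrite [#|[set i in A | _]|](_ : _ = #|[pred i in A | T \subset S i]|).
    rewrite -ler_pdivlMr ?exprn_gt0 // => sprT.
    apply: (@le_trans _ _ (M / (p * kappa) ^+ #|T|)).
      rewrite exprMn invfM mulrCA ler_wpM2l //.
      by rewrite invr_ge0 exprn_ge0 // ltW.
    rewrite ler_wpM2l // lef_pV2 ?posrE ?exprn_gt0 ?(lt_le_trans ltr01) //.
    exact: ler_weXn2l.
  by apply: eq_card => i; rewrite !inE.
rewrite sumr_const card_powerset -mulrnAr ler_wpM2l ?weight_ge0 //.
rewrite -[leLHS]mulr_natr natrX /b -[leLHS]mulrA ler_wpM2l // mulrC.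
rewrite ler_wpM2r ?invr_ge0 ?exprn_ge0 ?(le_trans ler01) //.
by rewrite ler_weXn2l ?anchor_card // ler1n.
Qed.

(* The deficit [M - #|A|] accounts for the indices discarded in earlier rounds,
   so that the spread constant [M] never has to be renormalised. *)
Definition covers r q c := forall A S,
  (forall i, i \in A -> S i \subset D) -> (forall i, i \in A -> #|S i| <= r)%N ->
  spread A S ->
  M * expect D q (fun W => [forall i in A, ~~ (S i \subset W)]%:R)
    <= M - #|A|%:R + M * c.

(** All sets are empty: a nonempty [A] never fails and has at most [M] indices, while for empty [A]
    the right side is [M]. *)
Lemma covers0 : 0 <= M -> covers 0 0 0.
Proof.
move=> M0 A S SD S0 spr; rewrite mulr0 addr0.
have [->|[i iA]] := set_0Vmem A.
  rewrite cards0 subr0 -[leRHS]mulr1 ler_wpM2l //.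
  rewrite -[leRHS](expect_cst D 0) ler_expect ?lexx ?ler01 // => W _.
  by case: ([forall _ in _, _]).
rewrite (@eq_expect _ _ _ _ _ (fun=> 0)) => [|W].
  rewrite expect_cst mulr0 subr_ge0.
  have := spr set0; rewrite cards0 expr0 mulr1.
  rewrite (_ : [set i0 in A | _] = A) //; apply/setP => j.
  by rewrite inE sub0set andbT.
case: forallP => // /(_ i); rewrite iA /=.
by move: (S0 i iA); rewrite leqn0 cards_eq0 => /eqP ->; rewrite sub0set.
Qed.

(** After revealing [W] at density [p], indices with fragments larger than [t] are discarded and
    [cov] is applied to the other fragments, which inherit spread as subsets. The deficit grows by
    the number discarded, which [frag_large] bounds on average. *)
Lemma covers_step r t q c p : 0 < p <= 1 -> 0 <= q <= 1 -> 1 <= p * kappa -> 0 <= M ->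
  covers t q c -> covers r (p + q - p * q) (2 ^+ r / (p * kappa) ^+ t.+1 + c).
Proof.
move=> p01 q01 pk M0 cov A S SD Sr spr; rewrite -expect_union.
have p01' : 0 <= p <= 1 by case/andP: p01 => /ltW -> ->.
pose A' W := [set i in A | (#|frag A S W i| <= t)%N].
pose B W := [set i in A | (t < #|frag A S W i|)%N].
have AB W : #|A' W|%:R = #|A|%:R - #|B W|%:R :> R.
  apply/eqP; rewrite eq_sym subr_eq -natrD; apply/eqP; congr _%:R.
  rewrite -(cardsID (A' W) A); congr (_ + _)%N.
    by apply: eq_card => i; rewrite !inE; case: (i \in A).
  by apply: eq_card => i; rewrite !inE ltnNge; case: (i \in A); rewrite ?andbT ?andbF.
have k0 : 0 < kappa.
  by case/andP: p01 => p0 _; rewrite -(pmulr_rgt0 _ p0) (lt_le_trans ltr01).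
apply: (@le_trans _ _ (expect D p (fun W => 1 * (M - #|A|%:R + M * c) + 1 * #|B W|%:R))).
  rewrite -[leLHS]addr0 -[X in _ + X](mul0r (expect D p (fun=> 0))) -expect_lin.
  apply: ler_expect => // W WD; rewrite mul0r addr0 !mul1r.
  have -> : M - #|A|%:R + M * c + #|B W|%:R = M - #|A' W|%:R + M * c by rewrite AB; ring.
  apply: le_trans (cov (A' W) (frag A S W) _ _ _).
  - rewrite ler_wpM2l // ler_expect // => Z _.
    rewrite ler_nat; case: forallP => //= fA; case: forallP => //= -[] i.
    apply/implyP; rewrite inE => /andP[iA _]; apply/negP => /(sub_setU_frag iA)[j jA sj].
    by have := fA j; rewrite jA sj.
  - move=> i; rewrite inE => /andP[iA _].
    exact: subset_trans (frag_sub S W iA) (SD i iA).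
  - by move=> i; rewrite inE => /andP[].
  - move=> T; apply: le_trans (spr T); rewrite ler_wpM2r ?exprn_ge0 ?(ltW k0) //.
    rewrite ler_nat subset_leq_card //; apply/subsetP => i; rewrite !inE.
    by case/andP=> /andP[iA _] sT; rewrite iA (subset_trans sT) ?frag_sub.
have large : expect D p (fun W => #|B W|%:R) <= M * (2 ^+ r / (p * kappa) ^+ t.+1).
  exact: frag_large.
by rewrite expect_lin expect_cst !mul1r mulrDr; lra.
Qed.

Lemma covers_le r q q' c c' : 0 <= q -> q <= q' -> q' <= 1 -> c <= c' -> 0 <= M ->
  covers r q c -> covers r q' c'.
Proof.
move=> q0 qq' q'1 cc' M0 cov A S SD Sr spr.
apply: le_trans (_ : _ <= M - #|A|%:R + M * c) _; last by rewrite lerD2l ler_wpM2l.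
apply: le_trans (cov A S SD Sr spr).
rewrite ler_wpM2l // ler_expect_prob // => W Z WZ.
rewrite ler_nat; case: forallP => //= fZ; case: forallP => //= -[] i.
apply/implyP => iA; apply/negP => sW.
by have := fZ i; rewrite iA (subset_trans sW).
Qed.

(** The cost of a round from size [2 ^ x.+1] to [2 ^ x] with [p * kappa = 16], bounded by a
    difference so that the costs telescope. *)
Lemma halving_cost x :
  2 ^+ (2 ^ x.+1) / 16 ^+ (2 ^ x).+1 <= 2 ^- x - 2 ^- x.+1 :> R.
Proof.
have -> : 2 ^- x - 2 ^- x.+1 = 2 ^- x.+1 :> R.
  have : 2 ^+ x != 0 :> R by rewrite expf_neq0 ?pnatr_eq0.
  by rewrite exprS; move: (2 ^+ x) => y y0; field.
rewrite ler_pdivrMr ?exprn_gt0 // mulrC ler_pdivlMr ?exprn_gt0 //.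
have -> : 16 = 2 ^+ 4 :> R by ring.
rewrite -exprM -exprD ler_weXn2l ?ler1n //.
have := ltn_expl x (isT : 1 < 2)%N; rewrite expnS; lia.
Qed.

(** Each round put in front doubles the admissible size. Densities are summed using
    [p + q - p * q <= p + q]. *)
Lemma covers_halving (a j : nat) (q0 c0 : R) : 0 < kappa -> 0 <= M -> 0 <= q0 ->
  q0 + j%:R * (16 / kappa) <= 1 -> covers (2 ^ a) q0 c0 ->
  covers (2 ^ (a + j)) (q0 + j%:R * (16 / kappa)) (c0 + 2 ^- a - 2 ^- (a + j)).
Proof.
move=> k0 M0 q00; set p := 16 / kappa.
have p0 : 0 < p by rewrite divr_gt0.
elim: j => [|j IH] q1 cov; first by rewrite addn0 mul0r addr0 addrK.
have j0 : 0 <= j%:R * p by rewrite mulr_ge0 ?ler0n ?ltW.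
move: q1; rewrite -natr1 mulrDl mul1r => q1.
have qj1 : q0 + j%:R * p <= 1 by lra.
have pk : p * kappa = 16 by rewrite /p mulfVK ?lt0r_neq0.
have p01 : 0 < p <= 1 by rewrite p0; lra.
have qj01 : 0 <= q0 + j%:R * p <= 1 by apply/andP; split; lra.
have pk1 : 1 <= p * kappa by rewrite pk; lra.
have := covers_step (r := 2 ^ (a + j.+1)) p01 qj01 pk1 M0 (IH qj1 cov).
rewrite pk; apply: covers_le => //.
- rewrite -addrA; nra.
- nra.
- by have := halving_cost (a + j); rewrite addnS; lra.
Qed.

(* A single round with the large probability [K / kappa] removes the last edges. *)
Lemma spread_containment (a m : nat) (K : R) A S : 0 < kappa -> 1 <= K -> 0 < M ->
  (K + 16 * m%:R) / kappa <= 1 ->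
  (forall i, i \in A -> S i \subset D) -> (forall i, i \in A -> #|S i| <= 2 ^ (a + m))%N ->
  #|A|%:R = M -> spread A S ->
  expect D ((K + 16 * m%:R) / kappa) (fun W => [forall i in A, ~~ (S i \subset W)]%:R)
    <= 2 ^+ (2 ^ a) / K + 2 ^- a.
Proof.
move=> k0 K1 M0 q1 SD Sr cA spr.
have M0' := ltW M0.
have K0 : 0 < K by apply: lt_le_trans K1.
have K0' : 0 < K / kappa by rewrite divr_gt0.
have m0 : 0 <= m%:R * (16 / kappa) by rewrite mulr_ge0 ?ler0n // divr_ge0 // ltW.
have qE : (K + 16 * m%:R) / kappa = K / kappa + m%:R * (16 / kappa) by ring.
rewrite qE in q1 *.
have K1' : 0 < K / kappa <= 1 by rewrite K0'; lra.
have KK : K / kappa * kappa = K by rewrite mulfVK ?lt0r_neq0.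
(* With [t = 0] only empty fragments survive this round, so [covers0] finishes; the cost is
   [2 ^+ (2 ^ a) / K]. *)
have := covers_step (r := 2 ^ a) K1' (q := 0) _ _ M0' (covers0 M0').
rewrite KK lexx ler01 expr1 addr0 mulr0 subr0 addr0 => /(_ isT K1) cov.
have := covers_halving k0 M0' (ltW K0') q1 cov SD Sr spr.
rewrite cA subrr add0r ler_pM2l // => /le_trans; apply.
by rewrite gerBl invr_ge0 exprn_ge0.
Qed.
End Fragments.

(** * The comb threshold *)

From mathcomp Require Import all_classical all_reals.
From mathcomp Require Import topology normedtype sequences exp.
Import numFieldNormedType.Exports.
Local Open Scope classical_set_scope.
Local Open Scope ring_scope.

Section Asymptotics.
Variable R : realType.

(** Induction peels off one factor using [(n + 1) ^ v <= e * n ^ v] for [v <= n], which follows from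
    [1 + 1 / n <= exp (1 / n)]. *)
Lemma expn_le_ffact (n v : nat) : (v <= n)%N ->
  n%:R ^+ v <= expR 1 ^+ v * (n ^_ v)%:R :> R.
Proof.
elim: v n => [|v IH] n; first by rewrite ffactn0 !expr0 mul1r.
case: n => // n vn.
have step : n.+1%:R ^+ v <= expR 1 * n%:R ^+ v :> R.
  case: n vn => [|n] vn.
    by move: vn; rewrite ltnS leqn0 => /eqP ->; rewrite !expr0 mulr1 ltW // expR_gt1 ltr01.
  have n0 : 0 < n.+1%:R :> R by rewrite ltr0n.
  have -> : n.+2%:R = (1 + n.+1%:R^-1) * n.+1%:R :> R.
    by rewrite mulrDl mulVf ?lt0r_neq0 // mul1r natr1.
  rewrite exprMn ler_pM2r ?exprn_gt0 //.
  apply: (@le_trans _ _ (expR (n.+1%:R^-1) ^+ v)).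
    by rewrite lerXn2r ?nnegrE ?addr_ge0 ?expR_ge0 ?expR_ge1Dx ?invr_ge0 ?ler0n.
  rewrite -expRM_natl ler_expR ler_pdivrMr // mul1r ler_nat.
  exact: vn.
rewrite ffactSS natrM exprS exprS.
have := IH n vn; have e0 := expR_gt0 (1 : R); have n0 : 0 <= n.+1%:R :> R by rewrite ler0n.
move=> le; apply: (@le_trans _ _ (n.+1%:R * (expR 1 * n%:R ^+ v))).
  by rewrite ler_wpM2l.
apply: (@le_trans _ _ (n.+1%:R * (expR 1 * (expR 1 ^+ v * (n ^_ v)%:R)))).
  by rewrite ler_wpM2l // ler_pM2l.
by rewrite le_eqVlt; apply/orP; left; apply/eqP; ring.
Qed.

(** In [kappa] the 4 is the degree bound; [e ^ 2] arises from [n ^ v * (n - v)! <= e ^ v * n!] with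
    [v] at most twice the number of edges. *)
Lemma comb_spread (n m k : nat) : (0 < n)%N -> (m * k)%N = n ->
  spread (n%:R / (4 * expR 1 ^+ 2)) (n`!%:R : R)
    (injections n ('I_m * 'I_k)%type) (@edges n _ (@comb_adj m k)).
Proof.
move=> n0 mk T.
have cU : #|{: 'I_m * 'I_k}| = n by rewrite card_prod !card_ord.
have [v [vn vT]] := card_edges_sup cU (@comb_adj_sym m k) (@comb_depth_adj m k)
  (@comb_parent_uniq m k) (@comb_deg_le m k) T.
set N := #|_| => le.
have e1 : 1 <= expR 1 :> R by rewrite ltW // expR_gt1 ltr01.
have e0 := lt_le_trans ltr01 e1.
rewrite expr_div_n mulrA ler_pdivrMr ?exprn_gt0 ?mulr_gt0 ?exprn_gt0 //.
move: le; rewrite -(ler_nat R) !natrM !natrX => /le_trans; apply.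
rewrite exprMn [leRHS]mulrC -[leRHS]mulrA ler_wpM2l ?exprn_ge0 ?ler0n //.
apply: (@le_trans _ _ (expR 1 ^+ v * n`!%:R)).
  by rewrite -(ffact_fact vn) natrM mulrA ler_wpM2r ?ler0n ?expn_le_ffact.
by rewrite ler_wpM2r ?ler0n // -exprM mul2n ler_weXn2l.
Qed.

Lemma prob_combE (n k : nat) (p : R) : prob_comb n k p =
  expect (upper_pairs n) p (fun W => (contains_comb (n %/ k) k W)%:R).
Proof.
rewrite /prob_comb /gnp_prob big_mkcondr; apply: eq_bigr => W _.
by rewrite /weight; case: (contains_comb _ _ _); rewrite ?mulr1 ?mulr0.
Qed.

Lemma prob_comb_le1 (n k : nat) (p : R) : 0 <= p <= 1 -> prob_comb n k p <= 1.
Proof.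
move=> p01; rewrite prob_combE -[leRHS](expect_cst (upper_pairs n) p).
by apply: ler_expect => // W _; case: (contains_comb _ _ _); rewrite ?ler01.
Qed.

(** A copy has at most [n <= 2 ^ j] edges, so [j] halving rounds suffice; the last round also takes
    [K = j], for a total density of [17 * j / kappa]. *)
Lemma prob_comb_ge (n k a j : nat) (p : R) : (0 < k)%N -> (k %| n)%N -> (0 < n)%N ->
  (0 < j)%N -> (n <= 2 ^ j)%N -> 17 * j%:R / (n%:R / (4 * expR 1 ^+ 2)) <= p -> p <= 1 ->
  1 - (2 ^+ (2 ^ a) / j%:R + 2 ^- a) <= prob_comb n k p.
Proof.
move=> k0 kn n0 j0 nj qp p1; set m := (n %/ k)%N.
have mk : (m * k)%N = n by rewrite divnK.
have cU : #|{: 'I_m * 'I_k}| = n by rewrite card_prod !card_ord.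
set kappa := n%:R / _ in qp.
have kappa0 : 0 < kappa by rewrite divr_gt0 ?ltr0n // mulr_gt0 ?exprn_gt0 ?expR_gt0.
have qE : 17 * j%:R = j%:R + 16 * j%:R :> R by ring.
have q0 : 0 <= 17 * j%:R / kappa by apply: divr_ge0; [rewrite mulr_ge0 ?ler0n | exact: ltW].
pose fail (W : {set 'I_n * 'I_n}) : R :=
  [forall g in injections n ('I_m * 'I_k)%type, ~~ (edges (@comb_adj m k) g \subset W)]%:R.
have : expect (upper_pairs n) (17 * j%:R / kappa) fail <= 2 ^+ (2 ^ a) / j%:R + 2 ^- a.
  rewrite qE; apply: (spread_containment (M := n`!%:R)) => //.
  - by rewrite ler1n.
  - by rewrite ltr0n fact_gt0.
  - by rewrite -qE (le_trans qp).
  - move=> g _; apply/fintype.subsetP => e; rewrite !inE => /andP[//].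
  - move=> g gI; apply: leq_trans (card_edges_le cU (@comb_adj_sym m k) (@comb_depth_adj m k)
      (@comb_parent_uniq m k) gI) _.
    by apply: leq_trans nj _; rewrite leq_exp2l // leq_addl.
  - by rewrite card_injections.
  - exact: comb_spread.
move=> le_fail.
have le_fail' : expect (upper_pairs n) p fail <= 2 ^+ (2 ^ a) / j%:R + 2 ^- a.
  apply: le_trans le_fail; apply: ler_expect_prob => // W Z WZ.
  rewrite ler_nat; case: forallP => //= fZ; case: forallP => //= -[] g.
  apply/implyP => gI; apply/negP => sW.
  by have := fZ g; rewrite gI (fintype.subset_trans sW).
(* Either [W] contains a comb or every labelling fails on it, so the two indicators add up to at
   least 1. *)
have : 1 <= prob_comb n k p + expect (upper_pairs n) p fail; last by lra.
rewrite prob_combE -[X in X + _]mul1r -[X in _ + X]mul1r -expect_lin.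
rewrite -[leLHS](expect_cst (upper_pairs n) p); apply: ler_expect => [|W _].
  by rewrite p1 (le_trans q0).
rewrite !mul1r -natrD ler1n addn_gt0 !lt0b -implyNb; apply/implyP => nc.
apply/forall_inP => g; rewrite inE => /injectiveP gI.
by apply: contra nc; apply: contains_comb_edges.
Qed.

Lemma sqrn_le_exp2 x : (4 <= x)%N -> (x * x <= 2 ^ x)%N.
Proof.
elim: x => // x IH; rewrite leq_eqVlt => /predU1P[<-//|x4].
by have := IH x4; rewrite expnS; nia.
Qed.

End Asymptotics.

Theorem theorem1p2 (R : realType) :
  exists C : R, 0 < C /\
    forall k : nat -> nat,
      (forall n : nat, (0 < n)%N -> (0 < k n)%N /\ (k n %| n)%N) ->
      (fun n : nat => prob_comb n (k n) (C * ln (n%:R : R) / n%:R))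
        @ \oo --> (1 : R).
Proof.
have ln20 : 0 < ln 2 :> R by rewrite ln_gt0 // ltr1n.
(* Here 136 is [17 * 4 * 2]: density 17 per round index, 4 from [kappa], and 2 from
   [x + 1 <= 2 * log_2 n], where [x] is the floor of [log_2 n]. *)
pose C : R := 136 * expR 1 ^+ 2 / ln 2.
have C0 : 0 < C by rewrite divr_gt0 // mulr_gt0 // exprn_gt0 // expR_gt0.
exists C; split=> // k kP; apply/cvgrPdist_le => e e0.
pose a := Num.bound (2 / e).
have a_e : 2 ^- a <= e / 2.
  have : 2 / e < a%:R by rewrite archi_boundP // divr_ge0 // ltW.
  move=> a_gt; rewrite -[leRHS]invrK lef_pV2 ?posrE ?exprn_gt0 ?invr_gt0 ?divr_gt0 //.
  rewrite invf_div (le_trans (ltW a_gt)) // -natrX ler_nat ltnW //.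
  exact: ltn_expl.
(* Once [x + 1] exceeds [B], the last-round error [2 ^+ (2 ^ a) / (x + 1)] is at most [e / 2]. *)
pose B := 2 ^+ (2 ^ a) * 2 / e.
have B0 : 0 <= B by rewrite divr_ge0 ?mulr_ge0 ?exprn_ge0 // ltW.
pose b := Num.bound B.
(* For [2 * C <= x] the density is at most 1, since [C * ln n <= C * (x + 1) <= x * x <= n]. *)
pose c := Num.bound (2 * C).
exists (2 ^ (maxn 4 (maxn b c)))%N => // n /= hn.
pose x := trunc_log 2 n.
have n0 : (0 < n)%N by apply: leq_trans hn; rewrite expn_gt0.
have [kn0 kn] := kP n n0.
have : (maxn 4 (maxn b c) <= x)%N by apply: trunc_log_max.
rewrite !geq_max => /and3P[x4 bx cx].
have nx : (n < 2 ^ x.+1)%N by apply: trunc_log_ltn.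
have xn : (2 ^ x <= n)%N by apply: trunc_logP.
have nR0 : 0 < n%:R :> R by rewrite ltr0n.
have x4R : 4 <= x%:R :> R by rewrite ler_nat.
have lnn : x%:R * ln 2 <= ln n%:R :> R.
  by rewrite mulr_natl -lnXn // -natrX ler_ln ?posrE ?ltr0n ?expn_gt0 // ler_nat.
have p_ge : 17 * x.+1%:R / (n%:R / (4 * expR 1 ^+ 2)) <= C * ln n%:R / n%:R :> R.
  rewrite invf_div mulrA ler_pM2r ?invr_gt0 // /C.
  have : x.+1%:R <= 2 * (ln n%:R / ln 2) :> R.
    rewrite mulrA ler_pdivlMr // -natr1; nra.
  have E0 : 0 < expR 1 ^+ 2 :> R by rewrite exprn_gt0 ?expR_gt0.
  move: (expR 1 ^+ 2) E0 => E E0.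
  have -> : 136 * E / ln 2 * ln n%:R = 68 * E * (2 * (ln n%:R / ln 2)) :> R by ring.
  have -> : 17 * x.+1%:R * (4 * E) = 68 * E * x.+1%:R :> R by ring.
  by rewrite ler_pM2l // mulr_gt0.
have p_le1 : C * ln n%:R / n%:R <= 1 :> R.
  rewrite ler_pdivrMr // mul1r.
  have ln_le : ln n%:R <= x.+1%:R :> R.
    rewrite -ler_expR lnK ?posrE // -[x.+1%:R]mulr1 expRM_natl.
    apply: (@le_trans _ _ (2 ^+ x.+1)); first by rewrite -natrX ler_nat ltnW.
    rewrite lerXn2r ?nnegrE ?expR_ge0 //.
    by have := @expR_ge1Dx R 1; rewrite -natr1; apply: le_trans.
  have cR : 2 * C <= x%:R.
    have : 2 * C < c%:R by rewrite archi_boundP // mulr_ge0 // ltW.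
    by move/ltW/le_trans; apply; rewrite ler_nat.
  have xxn : x%:R * x%:R <= n%:R :> R.
    by rewrite -natrM ler_nat (leq_trans (sqrn_le_exp2 x4)).
  rewrite -natr1 in ln_le; nra.
have p_ge0 : 0 <= C * ln n%:R / n%:R :> R.
  by rewrite divr_ge0 ?ler0n // mulr_ge0 ?ln_ge0 ?ler1n // ltW.
have := prob_comb_ge a kn0 kn n0 (ltn0Sn x) (ltnW nx) p_ge p_le1.
have : 2 ^+ (2 ^ a) / x.+1%:R <= e / 2 :> R.
  have xR : B < x.+1%:R.
    apply: lt_le_trans (_ : b%:R <= _); first exact: archi_boundP.
    by rewrite ler_nat leqW.
  rewrite ler_pdivrMr ?ltr0n // mulrC; move: xR; rewrite /B ltr_pdivrMr //; lra.
have p01 : 0 <= C * ln n%:R / n%:R <= 1 by rewrite p_ge0.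
have := prob_comb_le1 n (k n) p01.
move=> le1 small ge; rewrite ger0_norm ?subr_ge0 // lerBlDr -lerBlDl.
apply: le_trans ge; rewrite lerD2l lerN2 [leRHS]splitr.
exact: lerD.
Qed.
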